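(* Let $\alpha,\beta,\gamma\in\mathbb{R}\setminus\{0\}$, let $g:\mathbb{O}(\alpha,\beta,\gamma)\to\mathbb{O}(\alpha,\beta,\gamma)$ be a continuous function, and let $L$ and $\mathfrak{L}g$ be as defined in the context. Let $x^0\in\mathbb{O}(\alpha,\beta,\gamma)$. If $x^0$ is a root of the equation $g(x)=0$ in $\mathbb{O}(\alpha,\beta,\gamma)$, then $L(x^0)$ is a root of the equation $\mathfrak{L}g(L(x))=0$ in $\mathbb{O}(1,1,1)$ or $\mathbb{O}(1,1,-1)$ (depending on the signs of $\alpha,\beta,\gamma$), that is, $\mathfrak{L}g(L(x^0))=0$. Conversely, if $L(x^0)$ is a root of $\mathfrak{L}g(L(x))=0$, then $x^0$ is a root of $g(x)=0$.
   Context: For $\alpha,\beta,\gamma\in\mathbb{R}\setminus\{0\}$, the generalized octonion algebra $\mathbb{O}(\alpha,\beta,\gamma)$ is the unital (non-associative) real algebra with basis $\{1,f_1,\dots,f_7\}$, unit $1$, with $f_1^2=-\alpha$, $f_2^2=-\beta$, $f_3^2=-\alpha\beta$, $f_4^2=-\gamma$, $f_5^2=-\alpha\gamma$, $f_6^2=-\beta\gamma$, $f_7^2=-\alpha\beta\gamma$, with $f_pf_q=-f_qf_p$ for $p\neq q$, and $f_1f_2=f_3$, $f_1f_3=-\alpha f_2$, $f_1f_4=f_5$, $f_1f_5=-\alpha f_4$, $f_1f_6=-f_7$, $f_1f_7=\alpha f_6$, $f_2f_3=\beta f_1$, $f_2f_4=f_6$, $f_2f_5=f_7$, $f_2f_6=-\beta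 f_4$, $f_2f_7=-\beta f_5$, $f_3f_4=f_7$, $f_3f_5=-\alpha f_6$, $f_3f_6=\beta f_5$, $f_3f_7=-\alpha\beta f_4$, $f_4f_5=\gamma f_1$, $f_4f_6=\gamma f_2$, $f_4f_7=\gamma f_3$, $f_5f_6=-\gamma f_3$, $f_5f_7=\alpha\gamma f_2$, $f_6f_7=-\beta\gamma f_1$. The canonical basis of $\mathbb{O}(1,1,1)$ is written $1,\widetilde{f_1},\dots,\widetilde{f_7}$ and that of $\mathbb{O}(1,1,-1)$ is written $1,\widehat{f_1},\dots,\widehat{f_7}$. These spaces carry their usual topology as 8-dimensional real vector spaces. $L$ is the $\mathbb{R}$-linear bijection from $\mathbb{O}(\alpha,\beta,\gamma)$ onto $\mathbb{O}(1,1,1)$ (in case 1) or $\mathbb{O}(1,1,-1)$ (in cases 2–8) with $L(1)=1$ and $(L(f_1),\dots,L(f_7))$ equal to: 1) if $\alpha,\beta,\gamma>0$: $(\sqrt{\alpha}\widetilde{f_1},\sqrt{\beta}\widetilde{f_2},\sqrt{\alpha\beta}\widetilde{f_3},\sqrt{\gamma}\widetilde{f_4},\sqrt{\alpha\gamma}\widetilde{f_5},\sqrt{\beta\gamma}\widetilde{f_6},\sqrt{\alpha\beta\gamma}\widetilde{f_7})$; 2) if $\alpha,\beta>0,\gamma<0$: $(\sqrt{\alpha}\widehat{f_1},\sqrt{\beta}\widehat{f_2},\sqrt{\alpha\beta}\widehat{f_3},\sqrt{-\gamma}\widehat{f_4},\sqrt{-\alpha\gamma}\widehat{f_5},\sqrt{-\beta\gamma}\widehat{f_6},\sqrt{-\alpha\beta\gamma}\widehat{f_7})$;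 3) if $\alpha,\gamma>0,\beta<0$: $(\sqrt{\alpha}\widehat{f_1},\sqrt{-\beta}\widehat{f_4},\sqrt{-\alpha\beta}\widehat{f_5},\sqrt{\gamma}\widehat{f_2},\sqrt{\alpha\gamma}\widehat{f_3},\sqrt{-\beta\gamma}\widehat{f_6},\sqrt{-\alpha\beta\gamma}\widehat{f_7})$; 4) if $\alpha>0,\beta,\gamma<0$: $(\sqrt{\alpha}\widehat{f_1},\sqrt{-\beta}\widehat{f_4},\sqrt{-\alpha\beta}\widehat{f_5},\sqrt{-\gamma}\widehat{f_6},\sqrt{-\alpha\gamma}\widehat{f_7},\sqrt{\beta\gamma}\widehat{f_2},\sqrt{\alpha\beta\gamma}\widehat{f_3})$; 5) if $\alpha<0,\beta,\gamma>0$: $(\sqrt{-\alpha}\widehat{f_4},\sqrt{\beta}\widehat{f_1},\sqrt{-\alpha\beta}\widehat{f_5},\sqrt{\gamma}\widehat{f_2},\sqrt{-\alpha\gamma}\widehat{f_6},\sqrt{\beta\gamma}\widehat{f_3},\sqrt{-\alpha\beta\gamma}\widehat{f_7})$; 6) if $\alpha,\gamma<0,\beta>0$: $(\sqrt{-\alpha}\widehat{f_4},\sqrt{\beta}\widehat{f_1},\sqrt{-\alpha\beta}\widehat{f_5},\sqrt{-\gamma}\widehat{f_6},\sqrt{\alpha\gamma}\widehat{f_2},\sqrt{-\beta\gamma}\widehat{f_7},\sqrt{\alpha\beta\gamma}\widehat{f_3})$; 7) if $\alpha,\beta<0,\gamma>0$: $(\sqrt{-\alpha}\widehat{f_4},\sqrt{-\beta}\widehat{f_5},\sqrt{\alpha\beta}\widehat{f_1},\sqrt{\gamma}\widehat{f_2},\sqrt{-\alpha\gamma}\widehat{f_6},\sqrt{-\beta\gamma}\widehat{f_7},\sqrt{\alpha\beta\gamma}\widehat{f_3})$;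 8) if $\alpha,\beta,\gamma<0$: $(\sqrt{-\alpha}\widehat{f_4},\sqrt{-\beta}\widehat{f_5},\sqrt{\alpha\beta}\widehat{f_1},\sqrt{-\gamma}\widehat{f_6},\sqrt{\alpha\gamma}\widehat{f_2},\sqrt{\beta\gamma}\widehat{f_3},\sqrt{-\alpha\beta\gamma}\widehat{f_7})$. Write a continuous $g$ as $g(x)=g_0(x_0,\dots,x_7)+\sum_{k=1}^7g_k(x_0,\dots,x_7)f_k$ for $x=x_0+\sum_{k=1}^7x_kf_k$, with real-valued $g_k$. The function $\mathfrak{L}g$, defined on and taking values in the target algebra of $L$, is $\mathfrak{L}g:=g_0+\sum_{k=1}^7g_k\,L(f_k)$, where, at the point $L(x)$, the functions $g_k$ are evaluated at the coordinates $(x_0,\dots,x_7)$ of $x$; i.e. $\mathfrak{L}g(L(x))=g_0(x_0,\dots,x_7)+\sum_{k=1}^7g_k(x_0,\dots,x_7)L(f_k)$. *)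

(* Defs.v *)
From HB Require Import structures.
From mathcomp Require Import all_boot all_order all_algebra.
From mathcomp Require Import all_classical all_reals all_analysis.

Set Implicit Arguments.
Unset Strict Implicit.
Unset Printing Implicit Defensive.

Import Order.TTheory GRing.Theory Num.Theory.
Import numFieldNormedType.Exports.

Local Open Scope ring_scope.

(* The algebra O(a,b,c).  An element is the row of its coordinates in the basis
   1, f_1, ..., f_7.  The type depends on a, b, c because the product, declared
   below as a (non-associative) magma structure with notation [*%g], does. *)
Definition genoct (R : realType) (a b c : R) : Type := 'rV[R]_8.

HB.instance Definition _ (R : realType) (a b c : R) :=
  NormedModule.copy (genoct a b c) 'rV[R]_8.

Local Notation "s \f_ r" := (s%R, r%N) (at level 41).

Section GeneralizedOctonions.
Variables (R : realType) (a b c : R).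
Local Notation O := (genoct a b c).

Definition octcoord (x : O) (k : nat) : R := (x : 'rV[R]_8) 0 (inord k).

(* [octbasis k] is f_k for 1 <= k <= 7, and [octbasis 0] is the unit. *)
Definition octbasis (k : nat) : O := (delta_mx 0 (inord k) : 'rV[R]_8).

(* [octtable p q = (s, r)] encodes f_p f_q = s f_r, for p <= q or q = 0. *)
Definition octtable (p q : nat) : R * nat :=
  match p, q with
  | 0, _ => 1 \f_ q
  | _, 0 => 1 \f_ p
  | 1, 1 => - a \f_ 0
  | 1, 2 => 1 \f_ 3
  | 1, 3 => - a \f_ 2
  | 1, 4 => 1 \f_ 5
  | 1, 5 => - a \f_ 4
  | 1, 6 => - 1 \f_ 7
  | 1, 7 => a \f_ 6
  | 2, 2 => - b \f_ 0
  | 2, 3 => b \f_ 1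
  | 2, 4 => 1 \f_ 6
  | 2, 5 => 1 \f_ 7
  | 2, 6 => - b \f_ 4
  | 2, 7 => - b \f_ 5
  | 3, 3 => - (a * b) \f_ 0
  | 3, 4 => 1 \f_ 7
  | 3, 5 => - a \f_ 6
  | 3, 6 => b \f_ 5
  | 3, 7 => - (a * b) \f_ 4
  | 4, 4 => - c \f_ 0
  | 4, 5 => c \f_ 1
  | 4, 6 => c \f_ 2
  | 4, 7 => c \f_ 3
  | 5, 5 => - (a * c) \f_ 0
  | 5, 6 => - c \f_ 3
  | 5, 7 => a * c \f_ 2
  | 6, 6 => - (b * c) \f_ 0
  | 6, 7 => - (b * c) \f_ 1
  | 7, 7 => - (a * b * c) \f_ 0
  | _, _ => 0 \f_ 0
  end%N.

Definition octbasis_mul (p q : nat) : O :=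
  if (p <= q)%N || (q == 0)%N
  then (octtable p q).1 *: octbasis (octtable p q).2
  else - ((octtable q p).1 *: octbasis (octtable q p).2).

Definition octmul (x y : O) : O :=
  \sum_(0 <= p < 8) \sum_(0 <= q < 8)
     (octcoord x p * octcoord y q) *: octbasis_mul p q.

HB.instance Definition _ := hasMul.Build O octmul.

Lemma octbasis_coord (j k : nat) : (j < 8)%N -> (k < 8)%N ->
  octcoord (octbasis j) k = (j == k)%:R.
Proof.
by move=> j8 k8; rewrite /octcoord mxE eqxx -val_eqE /= !inordK// eq_sym.
Qed.

Lemma octcoordE (x : O) : x = \sum_(0 <= k < 8) octcoord x k *: octbasis k.
Proof.
rewrite big_mkord [LHS](row_sum_delta (x : 'rV[R]_8)).
by apply: eq_bigr => i _; rewrite /octcoord /octbasis inord_val.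
Qed.

Let big_octbasis (V : lmodType R) (j : nat) (F : nat -> V) : (j < 8)%N ->
  \sum_(0 <= k < 8) octcoord (octbasis j) k *: F k = F j.
Proof.
move=> j8; rewrite (bigD1_seq j) /= ?mem_index_iota ?iota_uniq//.
rewrite octbasis_coord// eqxx scale1r big_seq_cond big1 ?addr0// => i.
rewrite mem_index_iota => /andP[/= i8 ij].
by rewrite octbasis_coord// eq_sym (negPf ij) scale0r.
Qed.

Lemma octbasis_mulE (p q : nat) : (p < 8)%N -> (q < 8)%N ->
  (octbasis p * octbasis q)%g = octbasis_mul p q.
Proof.
move=> p8 q8; transitivity (octmul (octbasis p) (octbasis q)) => //.
rewrite /octmul.
under eq_bigr => i _.
  under eq_bigr => j _ do rewrite -scalerA.
  rewrite -scaler_sumr big_octbasis//.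
  over.
by rewrite (big_octbasis (fun i => octbasis_mul i q)).
Qed.

Let oct_mul1 : left_id (octbasis 0) octmul.
Proof.
move=> x; rewrite /octmul.
under eq_bigr => i _.
  under eq_bigr => j _ do rewrite -scalerA.
  rewrite -scaler_sumr.
  over.
rewrite big_octbasis// [RHS]octcoordE; apply: eq_bigr => j _.
by rewrite /octbasis_mul /= scale1r.
Qed.

Let oct_1mul : right_id (octbasis 0) octmul.
Proof.
move=> x; rewrite /octmul.
under eq_bigr => i _.
  under eq_bigr => j _ do rewrite -scalerA.
  rewrite -scaler_sumr big_octbasis//.
  over.
rewrite [RHS]octcoordE; apply: eq_bigr => j _.
by do 8?[case: j => [|j]]; rewrite /octbasis_mul /= scale1r.
Qed.

HB.instance Definition _ := Magma_isUMagma.Build O oct_mul1 oct_1mul.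

End GeneralizedOctonions.

Arguments octbasis {R a b c} k.

Section CanonicalMap.
Variables (R : realType) (a b c : R).

(* The target of L is O(1,1,1) when a, b, c > 0 and O(1,1,-1) otherwise. *)
Definition octsign : R := if [&& 0 < a, 0 < b & 0 < c] then 1 else -1.

Local Notation T := (genoct 1 1 octsign).

(* The entry (s, r) at position k - 1 encodes L(f_k) = s f_r.  As a, b, c are
   meant to be nonzero, "not positive" stands for "negative". *)
Definition octL_table : seq (R * nat) :=
  let r := @Num.sqrt R in
  if 0 < a then
    if 0 < b then
      if 0 < c then
        [:: r a \f_ 1; r b \f_ 2; r (a * b) \f_ 3; r c \f_ 4;
            r (a * c) \f_ 5; r (b * c) \f_ 6; r (a * b * c) \f_ 7]
      else
        [:: r a \f_ 1; r b \f_ 2; r (a * b) \f_ 3; r (- c) \f_ 4;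
            r (- (a * c)) \f_ 5; r (- (b * c)) \f_ 6; r (- (a * b * c)) \f_ 7]
    else
      if 0 < c then
        [:: r a \f_ 1; r (- b) \f_ 4; r (- (a * b)) \f_ 5; r c \f_ 2;
            r (a * c) \f_ 3; r (- (b * c)) \f_ 6; r (- (a * b * c)) \f_ 7]
      else
        [:: r a \f_ 1; r (- b) \f_ 4; r (- (a * b)) \f_ 5; r (- c) \f_ 6;
            r (- (a * c)) \f_ 7; r (b * c) \f_ 2; r (a * b * c) \f_ 3]
  else
    if 0 < b then
      if 0 < c then
        [:: r (- a) \f_ 4; r b \f_ 1; r (- (a * b)) \f_ 5; r c \f_ 2;
            r (- (a * c)) \f_ 6; r (b * c) \f_ 3; r (- (a * b * c)) \f_ 7]
      else
        [:: r (- a) \f_ 4; r b \f_ 1; r (- (a * b)) \f_ 5; r (- c) \f_ 6;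
            r (a * c) \f_ 2; r (- (b * c)) \f_ 7; r (a * b * c) \f_ 3]
    else
      if 0 < c then
        [:: r (- a) \f_ 4; r (- b) \f_ 5; r (a * b) \f_ 1; r c \f_ 2;
            r (- (a * c)) \f_ 6; r (- (b * c)) \f_ 7; r (a * b * c) \f_ 3]
      else
        [:: r (- a) \f_ 4; r (- b) \f_ 5; r (a * b) \f_ 1; r (- c) \f_ 6;
            r (a * c) \f_ 2; r (b * c) \f_ 3; r (- (a * b * c)) \f_ 7].

(* The image of the k-th basis vector; in particular L(1) = 1. *)
Definition octL_basis (k : nat) : T :=
  let sr := nth (0, 0%N) ((1, 0%N) :: octL_table) k in sr.1 *: octbasis sr.2.

Definition octL (x : genoct a b c) : T :=
  \sum_(0 <= k < 8) octcoord x k *: octL_basis k.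

Lemma octL_is_linear : linear octL.
Proof.
move=> s x y; rewrite /octL scaler_sumr -big_split; apply: eq_bigr => k _ /=.
by rewrite [in RHS]scalerA -scalerDl /octcoord !mxE.
Qed.

HB.instance Definition _ :=
  GRing.isLinear.Build R (genoct a b c) T *:%R octL octL_is_linear.

Lemma octL_octbasis (k : nat) : (k < 8)%N -> octL (octbasis k) = octL_basis k.
Proof.
move=> k8; rewrite /octL (bigD1_seq k) /= ?mem_index_iota ?iota_uniq//.
rewrite octbasis_coord// eqxx scale1r big_seq_cond big1 ?addr0// => i.
rewrite mem_index_iota => /andP[/= i8 ik].
by rewrite octbasis_coord// eq_sym (negPf ik) scale0r.
Qed.

Lemma octL1 : octL 1%g = 1%g.
Proof. by rewrite [LHS]octL_octbasis// /octL_basis scale1r. Qed.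

Lemma octL_table_perm : perm_eq (unzip2 octL_table) (iota 1 7).
Proof. by rewrite /octL_table; do 3!case: ifP => _. Qed.

Lemma octL_table_gt0 : a != 0 -> b != 0 -> c != 0 ->
  all (fun s => 0 < s) (unzip1 octL_table).
Proof.
move=> a0 b0 c0; rewrite /octL_table.
case: (ltgtP 0 a) a0 => [ha _|ha _|<-] => //.
all: case: (ltgtP 0 b) b0 => [hb _|hb _|<-] => //.
all: case: (ltgtP 0 c) c0 => [hc _|hc _|<-] => //.
all: rewrite /= !sqrtr_gt0 ?oppr_gt0 -?mulrA.
all: do ?[apply/andP; split]; do 3?[by []
  | rewrite pmulr_rgt0; last by [] | rewrite nmulr_rgt0; last by []
  | rewrite pmulr_rlt0; last by [] | rewrite nmulr_rlt0; last by []].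
Qed.

Lemma octL_bij : a != 0 -> b != 0 -> c != 0 -> bijective octL.
Proof.
move=> a0 b0 c0.
pose t := (1, 0%N) :: octL_table; pose s k := (nth (0, 0%N) t k).1.
pose r k := (nth (0, 0%N) t k).2.
have st : size t = 8%N.
  by rewrite /= -(size_map snd) (perm_size octL_table_perm).
have s0 k : (k < 8)%N -> s k != 0.
  move=> k8; apply: lt0r_neq0; have : all (fun s => 0 < s) (unzip1 t).
    by rewrite /= ltr01 octL_table_gt0.
  by move/all_nthP => /(_ 0 k); rewrite size_map st (nth_map (0, 0%N)) ?st//; exact.
have rt : perm_eq (unzip2 t) (iota 0 8) by rewrite /= perm_cons octL_table_perm.
have rE k : (k < 8)%N -> r k = nth 0%N (unzip2 t) k.
  by move=> k8; rewrite (nth_map (0, 0%N)) ?st.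
have r8 k : (k < 8)%N -> (r k < 8)%N.
  move=> k8; have : r k \in iota 0 8.
    by rewrite -(perm_mem rt) rE// mem_nth// size_map st.
  by rewrite mem_iota.
have r_inj i j : (i < 8)%N -> (j < 8)%N -> (r i == r j) = (i == j).
  move=> i8 j8; rewrite !rE// nth_uniq ?size_map ?st//.
  by rewrite (perm_uniq rt) iota_uniq.
have coordL x k : (k < 8)%N -> octcoord (octL x) (r k) = octcoord x k * s k.
  move=> k8; have -> : octcoord (octL x) (r k) =
      \sum_(0 <= i < 8) octcoord x i *
        (s i * octcoord (@octbasis R 1 1 octsign (r i)) (r k)).
    rewrite /octcoord /octL summxE; apply: eq_bigr => i _.
    by rewrite mxE [in LHS]mxE.
  rewrite (bigD1_seq k) /= ?mem_index_iota ?iota_uniq//.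
  rewrite octbasis_coord ?r8// eqxx mulr1 big_seq_cond big1 ?addr0// => i.
  rewrite mem_index_iota => /andP[/= i8 ik].
  by rewrite octbasis_coord ?r8// r_inj// (negPf ik) !mulr0.
have coord_eq (a' b' c' : R) (x y : genoct a' b' c') :
    (forall k, (k < 8)%N -> octcoord x k = octcoord y k) -> x = y.
  move=> xy; rewrite [LHS]octcoordE [RHS]octcoordE.
  by apply: eq_big_nat => k k8; rewrite xy.
pose Li (y : T) : genoct a b c :=
  \sum_(0 <= k < 8) (octcoord y (r k) / s k) *: octbasis k.
have coordLi y k : (k < 8)%N -> octcoord (Li y) k = octcoord y (r k) / s k.
  move=> k8; have -> : octcoord (Li y) k =
      \sum_(0 <= i < 8) octcoord y (r i) / s i * octcoord (@octbasis R a b c i) k.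
    rewrite {1}/octcoord /Li summxE; apply: eq_bigr => i _.
    by rewrite mxE.
  rewrite (bigD1_seq k) /= ?mem_index_iota ?iota_uniq//.
  rewrite octbasis_coord// eqxx mulr1 big_seq_cond big1 ?addr0// => i.
  rewrite mem_index_iota => /andP[/= i8 ik].
  by rewrite octbasis_coord// (negPf ik) !mulr0.
exists Li => [x|y]; apply: coord_eq => k k8.
  by rewrite coordLi// coordL// mulfK// s0.
have : k \in unzip2 t by rewrite (perm_mem rt) mem_iota.
case/(nthP 0%N) => j; rewrite size_map st => j8; rewrite -rE// => <-.
by rewrite coordL// coordLi// divfK// s0.
Qed.

(* The inverse of L; it is a genuine two-sided inverse for nonzero a, b, c. *)
Definition octLinv (y : T) : genoct a b c := xget 0 [set x | octL x = y]%classic.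

Lemma octLK : a != 0 -> b != 0 -> c != 0 -> cancel octL octLinv.
Proof.
move=> a0 b0 c0 x; rewrite /octLinv; case: xgetP => [z _|/(_ x erefl)//].
by move/(bij_inj (octL_bij a0 b0 c0)).
Qed.

Lemma octLinvK : a != 0 -> b != 0 -> c != 0 -> cancel octLinv octL.
Proof.
move=> a0 b0 c0 y; have [Li _ LiK] := octL_bij a0 b0 c0.
by rewrite /octLinv; case: xgetP => [z _ ->//|/(_ (Li y))/(_ (LiK y))].
Qed.

(* frak-L g: at y = L(x), the coordinates g_k of g are evaluated at x. *)
Definition octLfun (g : genoct a b c -> genoct a b c) (y : T) : T :=
  let gk k := octcoord (g (octLinv y)) k in
  gk 0%N *: (1%g : T) + \sum_(1 <= k < 8) gk k *: octL (octbasis k).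

End CanonicalMap.

(* Main.v *)
Require Import Defs.
From mathcomp Require Import all_boot all_order all_algebra.
From mathcomp Require Import all_classical all_reals all_analysis.
Import Order.TTheory GRing.Theory Num.Theory.
Import numFieldNormedType.Exports.
Local Open Scope ring_scope.

(** The transported function is the conjugate of [g] by the canonical map: by
    linearity, the sum of the [g_k *: L(f_k)] is the image under [L] of the sum
    of the [g_k *: f_k], so that [octLfun g] sends [L(x)] to [L(g(x))].  As [L]
    is a linear bijection, [L(g(x))] vanishes exactly when [g(x)] does. *)

(** Evaluating the coordinates of [g] at [octLinv (octL x)] amounts to evaluating
    them at [x] only because [octL] is injective, whence the nonzero parameters. *)
Lemma octLfun_octL (R : realType) (a b c : R) (g : genoct a b c -> genoct a b c)
    (x : genoct a b c) :
  a != 0 -> b != 0 -> c != 0 -> octLfun g (octL x) = octL (g x).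
Proof.
move=> a0 b0 c0; rewrite /octLfun octLK// [RHS]/octL [RHS]big_ltn//.
congr (_ + _).
  by congr (_ *: _); rewrite /octL_basis scale1r.
by apply: eq_big_nat => k /andP[_ k8]; rewrite octL_octbasis.
Qed.

Theorem theorem6p2 (R : realType) (a b c : R)
    (a_neq0 : a != 0) (b_neq0 : b != 0) (c_neq0 : c != 0)
    (g : genoct a b c -> genoct a b c) (g_cont : continuous g)
    (x0 : genoct a b c) :
  (g x0 = 0 -> octLfun g (octL x0) = 0) /\
  (octLfun g (octL x0) = 0 -> g x0 = 0).
Proof.
rewrite octLfun_octL//; split=> [->|Lg0]; first exact: linear0.
by apply: (bij_inj (octL_bij a_neq0 b_neq0 c_neq0)); rewrite Lg0 linear0.
Qed.
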